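(* Let $\alpha>0$, $A\ge0$, $B>0$, $t>0$, and let $P_n(x,t)$ be the monic polynomials orthogonal on $[0,\infty)$ w.r.t. $w(x,t)=x^\alpha e^{-x}(A+B\theta(x-t))$, with norms $h_n(t)$ and recurrence $zP_n=P_{n+1}+\alpha_n(t)P_n+\beta_n(t)P_{n-1}$. Let $R_n(t)=Bt^\alpha e^{-t}\{P_n(t,t)\}^2/h_n(t)$. Then for $n\ge1$ the function $S_n(t):=1-1/R_n(t)$ satisfies $$S_n''=\frac{3S_n-1}{2S_n(S_n-1)}(S_n')^2-\frac{S_n'}{t}-\frac{\alpha^2}{2}\frac{(S_n-1)^2}{t^2S_n}+(2n+1+\alpha)\frac{S_n}{t}-\frac12\frac{S_n(S_n+1)}{S_n-1},$$ i.e. the fifth Painlev\'e equation $P_V(0,-\alpha^2/2,2n+1+\alpha,-1/2)$, and $$S_n(t)=\frac{\alpha_n(t)-(2n+\alpha+1)-t}{\alpha_n(t)-(2n+\alpha+1)}.$$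
   Context: $\theta$ is the Heaviside function ($1$ for $x>0$, $0$ otherwise); $P_n(t,t)$ is $P_n(x,t)$ at $x=t$; primes denote $d/dt$. The fifth Painlev\'e equation $P_V(a,b,c,d)$ is $y''=\left(\frac{1}{2y}+\frac{1}{y-1}\right)(y')^2-\frac{y'}{t}+\frac{(y-1)^2}{t^2}\left(ay+\frac{b}{y}\right)+c\frac{y}{t}+d\frac{y(y+1)}{y-1}$. *)

(* Defs.v *)
From Stdlib Require Import Reals.
From Coquelicot Require Export Coquelicot.
Open Scope R_scope.

Definition theta (x : R) : R := if Rlt_dec 0 x then 1 else 0.

(* Weight w(x,t) = x^alpha e^{-x} (A + B theta(x - t)) on (0, oo); set to 0 for x <= 0
   (for alpha > 0 this agrees with x^alpha = 0 at x = 0). *)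
Definition weight (alpha A B t x : R) : R :=
  if Rlt_dec 0 x then Rpower x alpha * exp (- x) * (A + B * theta (x - t)) else 0.

Definition int_0_infty (f : R -> R) (v : R) : Prop :=
  is_RInt_gen f (at_point 0) (Rbar_locally p_infty) v.

Fixpoint psum (c : nat -> R) (n : nat) (x : R) : R :=
  match n with
  | O => 0
  | S m => psum c m x + c m * x ^ m
  end.

Definition monic_poly_deg (n : nat) (p : R -> R) : Prop :=
  exists c : nat -> R, forall x, p x = x ^ n + psum c n x.

Definition monic_OPS (alpha A B : R) (P : nat -> R -> R -> R) (h : nat -> R -> R) : Prop :=
  forall t, 0 < t ->
    (forall n, monic_poly_deg n (fun x => P n x t)) /\
    (forall m n, m <> n ->
       int_0_infty (fun x => P m x t * P n x t * weight alpha A B t x) 0) /\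
    (forall n, int_0_infty (fun x => P n x t ^ 2 * weight alpha A B t x) (h n t)).

Definition three_term (P : nat -> R -> R -> R) (a b : nat -> R -> R) : Prop :=
  forall t, 0 < t -> forall n x,
    x * P n x t = P (S n) x t + a n t * P n x t
                  + (match n with O => 0 | S m => b n t * P m x t end).

Definition RnP (alpha B : R) (P : nat -> R -> R -> R) (h : nat -> R -> R) (n : nat) (t : R) : R :=
  B * Rpower t alpha * exp (- t) * (P n t t) ^ 2 / h n t.

Definition SnP (alpha B : R) (P : nat -> R -> R -> R) (h : nat -> R -> R) (n : nat) (t : R) : R := 1 - 1 / RnP alpha B P h n t.

(* Main.v *)
Require Import Defs.
From Stdlib Require Import Reals Lra Lia.
From Coquelicot Require Import Coquelicot.
Open Scope R_scope.

(** Write [L_t] for integration against the weight and [K = B t^alpha e^(-t)]. The weight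
jumps at [t], so integration by parts gives, for every polynomial [f],
[L_t (x f' + (alpha + 1 - x) f) = - t K f(t)]. Taking [f = P_n ^ 2] and [f = P_n P_(n-1)]
expresses [alpha_n] and its partial sums through [R_n], [beta_n] and
[r_n = K P_n(t,t) P_(n-1)(t,t) / h_(n-1)]. With the three-term recurrence at [x = t] this
gives [r_n ^ 2 = beta_n R_n R_(n-1)] and, by induction on [n],
[beta_n (1 - R_n - R_(n-1)) = n (n + alpha) + (2 n + alpha) r_n].
In the variable [t] one has [h_n' = - R_n h_n] and [(alpha_0 + ... + alpha_(n-1))' = - r_n],
hence [t R_n' = 2 r_n + (2 n + alpha) R_n - t R_n (1 - R_n)] and
[t r_n' = beta_n (R_(n-1) - R_n)]. The two algebraic relations eliminate [beta_n] and
[R_(n-1)], and eliminating [r_n] from the resulting system leaves the Painlevé equation. *)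

(** * Polynomial functions *)

Definition deg_lt (d : nat) (f : R -> R) : Prop :=
  exists c : nat -> R, forall x, f x = psum c d x.

Definition is_poly (f : R -> R) : Prop := exists d, deg_lt d f.

Lemma psum_ext (c c' : nat -> R) d x :
  (forall k, (k < d)%nat -> c k = c' k) -> psum c d x = psum c' d x.
Proof.
  induction d as [|d IH]; simpl; intros H; [reflexivity|].
  rewrite IH, (H d); [reflexivity | lia |].
  intros k Hk; apply H; lia.
Qed.

Lemma psum_plus c c' d x :
  psum (fun k => c k + c' k) d x = psum c d x + psum c' d x.
Proof. induction d as [|d IH]; simpl; [|rewrite IH]; ring. Qed.

Lemma psum_scal l c d x : psum (fun k => l * c k) d x = l * psum c d x.
Proof. induction d as [|d IH]; simpl; [|rewrite IH]; ring. Qed.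

Lemma psum_shift c d x :
  psum (fun k => match k with O => 0 | S j => c j end) (S d) x = x * psum c d x.
Proof.
  induction d as [|d IH]; [simpl; ring|].
  change (psum (fun k => match k with O => 0 | S j => c j end) (S d) x
          + c d * x ^ S d = x * (psum c d x + c d * x ^ d)).
  rewrite IH; simpl; ring.
Qed.

Lemma deg_lt_ext d (f g : R -> R) :
  (forall x, f x = g x) -> deg_lt d f -> deg_lt d g.
Proof. intros E [c H]; exists c; intros x; rewrite <- E; apply H. Qed.

Lemma deg_lt_plus d (f g : R -> R) :
  deg_lt d f -> deg_lt d g -> deg_lt d (fun x => f x + g x).
Proof.
  intros [c Hf] [c' Hg]; exists (fun k => c k + c' k); intros x.
  now rewrite psum_plus, Hf, Hg.
Qed.

Lemma deg_lt_scal d l (f : R -> R) : deg_lt d f -> deg_lt d (fun x => l * f x).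
Proof.
  intros [c Hf]; exists (fun k => l * c k); intros x.
  now rewrite psum_scal, Hf.
Qed.

Lemma deg_lt_mulX d (f : R -> R) : deg_lt d f -> deg_lt (S d) (fun x => x * f x).
Proof.
  intros [c Hf]; exists (fun k => match k with O => 0 | S j => c j end); intros x.
  now rewrite psum_shift, Hf.
Qed.

Lemma deg_lt_S d (f : R -> R) : deg_lt d f -> deg_lt (S d) f.
Proof.
  (* The sequence [c] is arbitrary from index [d] on, so its value at [d] has to be cut to 0. *)
  intros [c Hf]; exists (fun k => if Nat.ltb k d then c k else 0); intros x; simpl.
  rewrite Nat.ltb_irrefl, Hf, (psum_ext c (fun k => if Nat.ltb k d then c k else 0)).
  - ring.
  - intros k Hk; apply Nat.ltb_lt in Hk; now rewrite Hk.
Qed.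

Lemma deg_lt_le d d' (f : R -> R) : (d <= d')%nat -> deg_lt d f -> deg_lt d' f.
Proof. induction 1; intros Hf; auto using deg_lt_S. Qed.

Lemma deg_lt_zero d : deg_lt d (fun _ => 0).
Proof.
  exists (fun _ => 0); intros x.
  induction d as [|d IH]; simpl; [|rewrite <- IH]; ring.
Qed.

Lemma deg_lt_pow k : deg_lt (S k) (fun x => x ^ k).
Proof.
  induction k as [|k IH].
  - exists (fun _ => 1); intros x; simpl; ring.
  - exact (deg_lt_mulX _ _ IH).
Qed.

Lemma is_poly_ext (f g : R -> R) : (forall x, f x = g x) -> is_poly f -> is_poly g.
Proof. intros E [d H]; exists d; exact (deg_lt_ext d f g E H). Qed.

Lemma is_poly_pow k : is_poly (fun x => x ^ k).
Proof. exists (S k); apply deg_lt_pow. Qed.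

Lemma is_poly_plus (f g : R -> R) :
  is_poly f -> is_poly g -> is_poly (fun x => f x + g x).
Proof.
  intros [d Hf] [d' Hg]; exists (max d d'); apply deg_lt_plus.
  - apply (deg_lt_le d); [lia | exact Hf].
  - apply (deg_lt_le d'); [lia | exact Hg].
Qed.

Lemma is_poly_scal l (f : R -> R) : is_poly f -> is_poly (fun x => l * f x).
Proof. intros [d Hf]; exists d; now apply deg_lt_scal. Qed.

Lemma is_poly_mulX (f : R -> R) : is_poly f -> is_poly (fun x => x * f x).
Proof. intros [d Hf]; exists (S d); now apply deg_lt_mulX. Qed.

Lemma is_poly_mult (f g : R -> R) :
  is_poly f -> is_poly g -> is_poly (fun x => f x * g x).
Proof.
  intros [d [c Hf]] Hg.
  apply (is_poly_ext (fun x => psum c d x * g x)); [intros x; now rewrite Hf|].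
  clear f Hf; induction d as [|d IH].
  - exists O, (fun _ => 0); intros x; simpl; ring.
  - apply (is_poly_ext (fun x => psum c d x * g x + c d * (x ^ d * g x))).
    { intros x; simpl; ring. }
    apply is_poly_plus; [exact IH|]; apply is_poly_scal; clear IH.
    induction d as [|d IH].
    + apply (is_poly_ext g); [intros x; simpl; ring | exact Hg].
    + apply (is_poly_ext (fun x => x * (x ^ d * g x))); [intros x; simpl; ring|].
      now apply is_poly_mulX.
Qed.

Lemma is_poly_const l : is_poly (fun _ => l).
Proof. exists 1%nat, (fun _ => l); intros x; simpl; ring. Qed.

Lemma is_poly_id : is_poly (fun x => x).
Proof.
  apply (is_poly_ext (fun x => x ^ 1)); [intros x; ring | apply is_poly_pow].
Qed.

Lemma is_derive_psum c d (x : R) :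
  is_derive (psum c d) x
    (psum (fun k => INR (S k) * c (S k)) (pred d) x).
Proof.
  induction d as [|[|d] IH].
  - apply (is_derive_const 0).
  - apply (is_derive_ext (fun _ => c O)); [intros y; change (c O = 0 + c O * 1); ring|].
    exact (is_derive_const (c O) x).
  - change (pred (S (S d))) with (S d); change (pred (S d)) with d in IH.
    apply (is_derive_ext (fun y => psum c (S d) y + c (S d) * y ^ S d)); [easy|].
    change (psum (fun k => INR (S k) * c (S k)) (S d) x) with
      (psum (fun k => INR (S k) * c (S k)) d x + INR (S d) * c (S d) * x ^ d).
    apply (is_derive_plus (psum c (S d))); [exact IH|].
    auto_derive; [exact I|].
    change (c (S d) * (1 * (INR (S d) * x ^ d)) = INR (S d) * c (S d) * x ^ d); ring.
Qed.

Lemma deg_lt_derive d (f : R -> R) :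
  deg_lt d f -> exists f', deg_lt (pred d) f' /\ forall x, is_derive f x (f' x).
Proof.
  intros [c Hf]; eexists; split.
  - eexists; intros x; reflexivity.
  - intros x; apply (is_derive_ext (psum c d)); [intros y; now rewrite Hf|].
    apply is_derive_psum.
Qed.

Lemma is_poly_continuous (f : R -> R) (x : R) : is_poly f -> continuous f x.
Proof.
  intros [d Hf]; destruct (deg_lt_derive d f Hf) as [f' [_ Hd]].
  apply (ex_derive_continuous (V := R_NormedModule)); exists (f' x); apply Hd.
Qed.

(** Multiplying by [x] on the left avoids the exponent [d - 1], so the zero polynomial needs no
    separate statement. *)
Lemma deg_lt_bound d (f : R -> R) :
  deg_lt d f -> exists C, forall x, 1 <= x -> Rabs (f x) * x <= C * x ^ d.
Proof.
  intros [c Hf]; enough (exists C, forall x, 1 <= x -> Rabs (psum c d x) * x <= C * x ^ d)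
    as [C HC] by (exists C; intros x Hx; rewrite Hf; auto).
  clear f Hf; induction d as [|d [C IH]].
  - exists 0; intros x Hx; simpl; rewrite Rabs_R0; lra.
  - exists (Rabs C + Rabs (c d)); intros x Hx; specialize (IH x Hx); simpl.
    assert (Hp : 0 < x ^ d) by (apply pow_lt; lra).
    assert (H1 := Rabs_triang (psum c d x) (c d * x ^ d)).
    rewrite Rabs_mult, (Rabs_pos_eq (x ^ d)) in H1 by lra.
    assert (H2 := Rle_abs C); assert (H3 := Rabs_pos C).
    assert (H4 : C * x ^ d <= Rabs C * x ^ d) by (apply Rmult_le_compat_r; lra).
    assert (H5 : Rabs C * x ^ d <= Rabs C * x ^ d * x).
    { rewrite <- (Rmult_1_r (Rabs C * x ^ d)) at 1.
      apply Rmult_le_compat_l; [apply Rmult_le_pos|]; lra. }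
    assert (H6 : Rabs (psum c d x + c d * x ^ d) * x
                 <= (Rabs (psum c d x) + Rabs (c d) * x ^ d) * x)
      by (apply Rmult_le_compat_r; lra).
    nra.
Qed.

(** At a root [x >= 1] the lower-order part equals [- x ^ n], so [deg_lt_bound] forces [x <= C]. The
    witness is chosen beyond 1, [C] and [t]. *)
Lemma monic_poly_nonzero n (p : R -> R) t :
  monic_poly_deg n p -> exists x, t < x /\ p x <> 0.
Proof.
  intros [c Hp].
  destruct (deg_lt_bound n (psum c n)) as [C HC]; [now exists c|].
  exists (1 + Rabs C + Rabs t); assert (Ht := Rle_abs t); assert (HaC := Rle_abs C).
  assert (H1 := Rabs_pos C); assert (H2 := Rabs_pos t).
  set (x := 1 + Rabs C + Rabs t) in *; split; [unfold x; lra|].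
  assert (Hx : 1 <= x) by (unfold x; lra).
  specialize (HC x Hx); rewrite Hp; intros E.
  replace (psum c n x) with (- x ^ n) in HC by lra.
  assert (Hn : 0 < x ^ n) by (apply pow_lt; lra).
  rewrite Rabs_Ropp, (Rabs_pos_eq (x ^ n)), (Rmult_comm C) in HC by lra.
  apply Rmult_le_reg_l in HC; [unfold x in HC; lra | exact Hn].
Qed.

Lemma monic_poly_is_poly n (p : R -> R) : monic_poly_deg n p -> is_poly p.
Proof.
  intros [c Hp]; apply (is_poly_ext (fun x => x ^ n + psum c n x)); [now symmetry|].
  apply is_poly_plus; [apply is_poly_pow | now exists n, c].
Qed.

(** * The linear functional defined by the weight *)

(** Extension by 0 makes the Laguerre weight continuous on the whole line when [alpha > 0], so no
    one-sided calculus at 0 is required. *)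
Definition laguerre (alpha x : R) : R :=
  if Rlt_dec 0 x then Rpower x alpha * exp (- x) else 0.

Lemma laguerre_pos alpha x : 0 < x -> laguerre alpha x = Rpower x alpha * exp (- x).
Proof. intros Hx; unfold laguerre; destruct (Rlt_dec 0 x); [reflexivity | lra]. Qed.

Lemma laguerre_nonpos alpha x : x <= 0 -> laguerre alpha x = 0.
Proof. intros Hx; unfold laguerre; destruct (Rlt_dec 0 x); [lra | reflexivity]. Qed.

Lemma laguerre_gt0 alpha x : 0 < x -> 0 < laguerre alpha x.
Proof.
  intros Hx; rewrite laguerre_pos by exact Hx.
  apply Rmult_lt_0_compat; apply exp_pos.
Qed.

Lemma laguerre_ge0 alpha x : 0 <= laguerre alpha x.
Proof.
  destruct (Rlt_dec 0 x).
  - now apply Rlt_le, laguerre_gt0.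
  - rewrite laguerre_nonpos; lra.
Qed.

Lemma is_derive_laguerre alpha x :
  0 < x -> is_derive (laguerre alpha) x ((alpha / x - 1) * laguerre alpha x).
Proof.
  intros Hx; rewrite laguerre_pos by exact Hx; unfold Rpower.
  apply (is_derive_ext_loc (fun y => exp (alpha * ln y) * exp (- y))).
  - apply (filter_imp (fun y => 0 < y)); [|now apply open_gt].
    intros y Hy; symmetry; now apply laguerre_pos.
  - auto_derive; [exact Hx | field; lra].
Qed.

Lemma continuous_laguerre alpha (x : R) : 0 < alpha -> continuous (laguerre alpha) x.
Proof.
  intros Ha; destruct (Rtotal_order x 0) as [Hx|[->|Hx]].
  - apply (continuous_ext_loc _ (fun _ => 0)); [|apply continuous_const].
    apply (filter_imp (fun y => y < 0)); [|now apply open_lt].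
    intros y Hy; symmetry; apply laguerre_nonpos; lra.
  - apply continuity_pt_filterlim; intros eps Heps.
    (* This radius gives [y ^ alpha < eps] for [0 < y], and [exp (- y) < 1] only helps. *)
    exists (Rpower eps (/ alpha)); split; [apply exp_pos|].
    intros y [_ Hy]; unfold dist in *; simpl in *; unfold Rdist in *.
    rewrite (laguerre_nonpos alpha 0), Rminus_0_r in * by lra.
    rewrite Rabs_pos_eq by apply laguerre_ge0.
    destruct (Rlt_dec 0 y) as [H0|H0]; [|now rewrite laguerre_nonpos by lra].
    rewrite Rabs_pos_eq in Hy by lra; rewrite laguerre_pos by exact H0.
    assert (H1 : Rpower y alpha < eps).
    { rewrite <- (Rpower_1 eps Heps), <- (Rinv_l alpha), <- Rpower_mult by lra.
      apply Rlt_Rpower_l; [exact Ha | now split]. }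
    assert (H2 : exp (- y) < 1) by (rewrite <- exp_0; apply exp_increasing; lra).
    assert (H3 := exp_pos (- y)); assert (H4 : 0 < Rpower y alpha) by apply exp_pos.
    nra.
  - apply (ex_derive_continuous (V := R_NormedModule)); eexists.
    now apply is_derive_laguerre.
Qed.

(** The difference quotient of [x * f x] at 0 is just [f k]. For [alpha <= 1] the function
    [laguerre alpha] is not differentiable at 0, but the factor [x] repairs this. *)
Lemma is_derive_mulX_0 (f : R -> R) :
  continuous f 0 -> is_derive (fun x => x * f x) 0 (f 0).
Proof.
  intros Hf; apply is_derive_Reals; intros eps Heps.
  apply continuity_pt_filterlim in Hf.
  destruct (Hf eps Heps) as [d [Hd H]].
  exists (mkposreal d Hd); intros k Hk Hkd; simpl in Hkd.
  replace (((0 + k) * f (0 + k) - 0 * f 0) / k - f 0) with (f k - f 0)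
    by (rewrite Rplus_0_l; field; exact Hk).
  apply (H k); split.
  - split; [exact I | now apply not_eq_sym].
  - simpl; unfold Rdist; now rewrite Rminus_0_r.
Qed.

Lemma is_derive_mulX_laguerre alpha (f f' : R -> R) x :
  0 < alpha -> (forall y, is_derive f y (f' y)) ->
  is_derive (fun y => y * (f y * laguerre alpha y)) x
    ((x * f' x + (alpha + 1 - x) * f x) * laguerre alpha x).
Proof.
  intros Ha Hf; destruct (Rtotal_order x 0) as [Hx|[->|Hx]].
  - apply (is_derive_ext_loc (fun _ => 0)).
    + apply (filter_imp (fun y => y < 0)); [|now apply open_lt].
      intros y Hy; simpl; rewrite laguerre_nonpos by (apply Rlt_le, Hy); ring.
    + rewrite laguerre_nonpos, Rmult_0_r by lra; apply (is_derive_const 0).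
  - replace ((0 * f' 0 + (alpha + 1 - 0) * f 0) * laguerre alpha 0)
      with (f 0 * laguerre alpha 0) by (rewrite laguerre_nonpos by lra; ring).
    apply (is_derive_mulX_0 (fun y => f y * laguerre alpha y)).
    apply (continuous_mult (K := R_AbsRing)); [|now apply continuous_laguerre].
    apply (ex_derive_continuous (V := R_NormedModule)); eexists; apply Hf.
  - evar_last.
    + apply (is_derive_mult (fun y : R => y) (fun y => f y * laguerre alpha y)).
      * apply (is_derive_id x).
      * apply (is_derive_mult f (laguerre alpha)); [apply Hf | | exact Rmult_comm].
        now apply is_derive_laguerre.
      * exact Rmult_comm.
    + unfold plus, mult, one; simpl; field; lra.
Qed.

Section Functional.

Variables alpha A B : R.
Hypotheses (Halpha : 0 < alpha) (HA : 0 <= A) (HB : 0 < B).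

Definition laguerre_int (f : R -> R) (b : R) : R :=
  RInt (fun x => f x * laguerre alpha x) 0 b.

(* Integration against [weight alpha A B t], see [int_0_infty_functional]. *)
Definition functional (t : R) (f : R -> R) : R :=
  (A + B) * real (Lim (laguerre_int f) p_infty) - B * laguerre_int f t.

Lemma continuous_mul_laguerre (f : R -> R) (x : R) :
  is_poly f -> continuous (fun y => f y * laguerre alpha y) x.
Proof.
  intros Hf; apply (continuous_mult (K := R_AbsRing)).
  - now apply is_poly_continuous.
  - now apply continuous_laguerre.
Qed.

Lemma ex_RInt_mul_laguerre (f : R -> R) a b :
  is_poly f -> ex_RInt (fun x => f x * laguerre alpha x) a b.
Proof.
  intros Hf; apply (ex_RInt_continuous (V := R_CompleteNormedModule)).
  intros z _; now apply continuous_mul_laguerre.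
Qed.

Lemma laguerre_int_Chasles f a b :
  is_poly f ->
  laguerre_int f b = laguerre_int f a + RInt (fun x => f x * laguerre alpha x) a b.
Proof.
  intros Hf; symmetry; apply (RInt_Chasles (fun x => f x * laguerre alpha x));
    now apply ex_RInt_mul_laguerre.
Qed.

Lemma is_derive_laguerre_int f x :
  is_poly f -> is_derive (laguerre_int f) x (f x * laguerre alpha x).
Proof.
  intros Hf; apply (is_derive_RInt (fun y => f y * laguerre alpha y) (laguerre_int f) 0).
  - apply filter_forall; intros b; apply (RInt_correct (V := R_CompleteNormedModule)).
    now apply ex_RInt_mul_laguerre.
  - now apply continuous_mul_laguerre.
Qed.

(** The interval is split at the jump: the factor of the Laguerre weight is [A] before [t] and
    [A + B] after it. *)
Lemma is_RInt_weight t b f :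
  is_poly f -> 0 < t -> t <= b ->
  is_RInt (fun x => f x * weight alpha A B t x) 0 b
    ((A + B) * laguerre_int f b - B * laguerre_int f t).
Proof.
  intros Hf Ht Hb.
  replace ((A + B) * laguerre_int f b - B * laguerre_int f t) with
    (plus (A * laguerre_int f t) ((A + B) * RInt (fun x => f x * laguerre alpha x) t b))
    by (rewrite (laguerre_int_Chasles f t b Hf); unfold plus; simpl; ring).
  apply (is_RInt_Chasles (V := R_NormedModule) _ 0 t b).
  - apply (is_RInt_ext (V := R_NormedModule) (fun x => scal A (f x * laguerre alpha x))).
    + rewrite Rmin_left, Rmax_right by lra; intros x [H1 H2].
      unfold weight, laguerre, theta, scal; simpl; unfold mult; simpl.
      destruct (Rlt_dec 0 x); [|lra]; destruct (Rlt_dec 0 (x - t)); [lra|]; ring.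
    + apply (is_RInt_scal (V := R_NormedModule)).
      apply (RInt_correct (V := R_CompleteNormedModule)), ex_RInt_mul_laguerre, Hf.
  - apply (is_RInt_ext (V := R_NormedModule) (fun x => scal (A + B) (f x * laguerre alpha x))).
    + rewrite Rmin_left, Rmax_right by lra; intros x [H1 H2].
      unfold weight, laguerre, theta, scal; simpl; unfold mult; simpl.
      destruct (Rlt_dec 0 x); [|lra]; destruct (Rlt_dec 0 (x - t)); [|lra]; ring.
    + apply (is_RInt_scal (V := R_NormedModule)).
      apply (RInt_correct (V := R_CompleteNormedModule)), ex_RInt_mul_laguerre, Hf.
Qed.

Lemma int_0_infty_laguerre_int t f v :
  is_poly f -> 0 < t ->
  int_0_infty (fun x => f x * weight alpha A B t x) v ->
  is_lim (laguerre_int f) p_infty ((v + B * laguerre_int f t) / (A + B)).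
Proof.
  intros Hf Ht Hv.
  assert (Hw : is_lim (fun b => (A + B) * laguerre_int f b - B * laguerre_int f t) p_infty v).
  { intros P HP; destruct (Hv P HP) as [Q S HQ HS H].
    assert (Hb : Rbar_locally p_infty (fun b => t < b)) by now exists t.
    change (Rbar_locally p_infty
      (fun b => P ((A + B) * laguerre_int f b - B * laguerre_int f t))).
    apply (filter_imp (fun b => S b /\ t < b));
      [|exact (filter_and (F := Rbar_locally p_infty) _ _ HS Hb)].
    (* The filter of the lower endpoint is [at_point 0], so the pair of endpoints 0 and [b] is
       admissible. *)
    intros b [HSb Htb];  destruct (H 0 b HQ HSb) as [y [Hy Py]]; simpl in Hy.
    assert (E := is_RInt_weight t b f Hf Ht (Rlt_le _ _ Htb)).
    apply (is_RInt_unique (V := R_CompleteNormedModule)) in E.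
    apply (is_RInt_unique (V := R_CompleteNormedModule)) in Hy.
    rewrite <- E, Hy; exact Py. }
  apply (is_lim_ext (fun b => / (A + B) * ((A + B) * laguerre_int f b - B * laguerre_int f t
                                          + B * laguerre_int f t))).
  { intros b; field; lra. }
  replace (Finite ((v + B * laguerre_int f t) / (A + B)))
    with (Rbar_mult (/ (A + B)) (v + B * laguerre_int f t))
    by (simpl; f_equal; field; lra).
  apply is_lim_scal_l, is_lim_plus'; [exact Hw | apply is_lim_const].
Qed.

Lemma int_0_infty_functional t f v :
  is_poly f -> 0 < t ->
  int_0_infty (fun x => f x * weight alpha A B t x) v -> functional t f = v.
Proof.
  intros Hf Ht Hv; unfold functional.
  rewrite (is_lim_unique _ _ _ (int_0_infty_laguerre_int t f v Hf Ht Hv)); simpl.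
  field; lra.
Qed.

Lemma laguerre_int_ext f g b : (forall x, f x = g x) -> laguerre_int f b = laguerre_int g b.
Proof. intros E; apply RInt_ext; intros x _; now rewrite E. Qed.

Lemma laguerre_int_plus f g b :
  is_poly f -> is_poly g ->
  laguerre_int (fun x => f x + g x) b = laguerre_int f b + laguerre_int g b.
Proof.
  intros Hf Hg.
  etransitivity; [|apply (RInt_plus (V := R_CompleteNormedModule)
                (fun x => f x * laguerre alpha x) (fun x => g x * laguerre alpha x));
    now apply ex_RInt_mul_laguerre].
  apply RInt_ext; intros x _; unfold plus; simpl; ring.
Qed.

Lemma laguerre_int_scal l f b :
  is_poly f -> laguerre_int (fun x => l * f x) b = l * laguerre_int f b.
Proof.
  intros Hf.
  etransitivity; [|apply (RInt_scal (V := R_CompleteNormedModule)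
                     (fun x => f x * laguerre alpha x));
    now apply ex_RInt_mul_laguerre].
  apply RInt_ext; intros x _; unfold scal; simpl; unfold mult; simpl; ring.
Qed.

(** [functional] is built from [real (Lim ...)], a total function; linearity holds once these limits
    exist and are finite. *)
Definition moments_finite : Prop :=
  forall f, is_poly f -> ex_finite_lim (laguerre_int f) p_infty.

Hypothesis Hmom : moments_finite.

Lemma is_lim_laguerre_int f :
  is_poly f -> is_lim (laguerre_int f) p_infty (real (Lim (laguerre_int f) p_infty)).
Proof.
  intros Hf; destruct (Hmom f Hf) as [l Hl].
  now rewrite (is_lim_unique _ _ _ Hl).
Qed.

Lemma functional_ext t f g :
  (forall x, f x = g x) -> functional t f = functional t g.
Proof.
  intros E; unfold functional; rewrite (laguerre_int_ext f g t E).
  now rewrite (Lim_ext _ (laguerre_int g)) by (intros b; now apply laguerre_int_ext).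
Qed.

Lemma functional_plus t f g :
  is_poly f -> is_poly g ->
  functional t (fun x => f x + g x) = functional t f + functional t g.
Proof.
  intros Hf Hg; unfold functional; rewrite (laguerre_int_plus f g t Hf Hg).
  rewrite (is_lim_unique (laguerre_int (fun x => f x + g x)) p_infty
             (real (Lim (laguerre_int f) p_infty) + real (Lim (laguerre_int g) p_infty))).
  { simpl; ring. }
  apply (is_lim_ext (fun b => laguerre_int f b + laguerre_int g b)).
  { intros b; now rewrite laguerre_int_plus. }
  apply is_lim_plus'; now apply is_lim_laguerre_int.
Qed.

Lemma functional_scal t l f :
  is_poly f -> functional t (fun x => l * f x) = l * functional t f.
Proof.
  intros Hf; unfold functional; rewrite (laguerre_int_scal l f t Hf).
  rewrite (is_lim_unique (laguerre_int (fun x => l * f x)) p_infty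
             (Rbar_mult l (real (Lim (laguerre_int f) p_infty)))).
  { simpl; ring. }
  apply (is_lim_ext (fun b => l * laguerre_int f b)).
  { intros b; now rewrite laguerre_int_scal. }
  now apply is_lim_scal_l, is_lim_laguerre_int.
Qed.

(** The half-line integral does not depend on the jump position and cancels. All derivatives in [t]
    below come from this finite integral. *)
Lemma functional_sub s t f :
  is_poly f ->
  functional s f - functional t f = - B * RInt (fun x => f x * laguerre alpha x) t s.
Proof. intros Hf; unfold functional; rewrite (laguerre_int_Chasles f t s Hf); ring. Qed.

Lemma laguerre_int_parts f f' b :
  is_poly f -> is_poly f' -> (forall x, is_derive f x (f' x)) ->
  laguerre_int (fun x => x * f' x + (alpha + 1 - x) * f x) b = b * (f b * laguerre alpha b).
Proof.
  intros Hf Hf' Hd; unfold laguerre_int.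
  replace (b * (f b * laguerre alpha b))
    with (minus (b * (f b * laguerre alpha b)) (0 * (f 0 * laguerre alpha 0)))
    by (unfold minus, plus, opp; simpl; ring).
  apply (is_RInt_unique (V := R_CompleteNormedModule)).
  apply (is_RInt_derive (V := R_CompleteNormedModule)
           (fun x => x * (f x * laguerre alpha x))).
  - intros x _; now apply is_derive_mulX_laguerre.
  - intros x _; apply continuous_mul_laguerre.
    apply is_poly_plus; [now apply is_poly_mulX|].
    apply is_poly_mult; [|exact Hf].
    apply (is_poly_ext (fun y => (alpha + 1) + (-1) * y)); [intros y; ring|].
    apply is_poly_plus; [apply is_poly_const | apply is_poly_scal, is_poly_id].
Qed.

(** The integrand times the Laguerre weight is a total derivative. It integrates to 0 over the half
    line, and the right side is what the truncated term [B * laguerre_int f t] contributes. *)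
Lemma functional_parts t f f' :
  is_poly f -> is_poly f' -> (forall x, is_derive f x (f' x)) ->
  functional t (fun x => x * f' x + (alpha + 1 - x) * f x)
  = - (B * laguerre alpha t) * t * f t.
Proof.
  assert (Hpoly : forall f f', is_poly f -> is_poly f' ->
    is_poly (fun x => x * f' x + (alpha + 1 - x) * f x)).
  { clear f f'; intros f f' Hf Hf'.
    apply is_poly_plus; [now apply is_poly_mulX|].
    apply is_poly_mult; [|exact Hf].
    apply (is_poly_ext (fun y => (alpha + 1) + (-1) * y)); [intros y; ring|].
    apply is_poly_plus; [apply is_poly_const | apply is_poly_scal, is_poly_id]. }
  intros Hf Hf' Hd; unfold functional; rewrite laguerre_int_parts by assumption.
  enough (E : Lim (laguerre_int (fun x => x * f' x + (alpha + 1 - x) * f x)) p_infty = 0)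
    by (rewrite E; simpl; ring).
  (* The boundary term of [x f] is [b] times that of [f]; both converge, so the latter
     tends to 0. *)
  set (f1 := fun x => f x + x * f' x).
  assert (Hf1 : is_poly f1) by (apply is_poly_plus; [|apply is_poly_mulX]; assumption).
  assert (Hxf : is_poly (fun x => x * f x)) by now apply is_poly_mulX.
  assert (Hd1 : forall x, is_derive (fun x => x * f x) x (f1 x)).
  { intros x; evar_last.
    - apply (is_derive_mult (fun y : R => y) f x); [apply is_derive_id | apply Hd |].
      exact Rmult_comm.
    - unfold f1, plus, mult, one; simpl; ring. }
  apply is_lim_unique.
  apply (is_lim_ext_loc (fun b => / b * laguerre_int (fun x => x * f1 x
                           + (alpha + 1 - x) * (x * f x)) b)).
  { exists 0; intros b Hb.
    rewrite (laguerre_int_parts (fun x => x * f x) f1 b Hxf Hf1 Hd1).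
    rewrite laguerre_int_parts by assumption; field; lra. }
  replace (Finite 0) with (Rbar_mult 0 (real (Lim (laguerre_int (fun x => x * f1 x
                           + (alpha + 1 - x) * (x * f x))) p_infty)))
    by (simpl; f_equal; ring).
  apply is_lim_mult; [| now apply is_lim_laguerre_int, Hpoly | exact I].
  replace (Finite 0) with (Rbar_inv p_infty) by reflexivity.
  apply is_lim_inv; [apply is_lim_id | discriminate].
Qed.

(** The primitive of [p ^ 2] against the Laguerre weight is nondecreasing. If the functional
    vanished, [(A + B) * Lim = B * laguerre_int f t] would force it to be constant beyond [t], hence
    [p = 0] there. Only the part beyond [t] serves, since [A] may be 0. *)
Lemma functional_sq_neq0 t n p :
  0 < t -> monic_poly_deg n p -> functional t (fun x => p x ^ 2) <> 0.
Proof.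
  intros Ht Hp H0.
  assert (Hpp : is_poly p) by now apply (monic_poly_is_poly n).
  assert (Hp2 : is_poly (fun x => p x ^ 2)).
  { apply (is_poly_ext (fun x => p x * p x)); [intros x; ring | now apply is_poly_mult]. }
  set (f := fun x => p x ^ 2) in *.
  assert (Hpos : forall a b, a <= b -> 0 <= RInt (fun x => f x * laguerre alpha x) a b).
  { intros a b Hab; apply RInt_ge_0; [exact Hab | now apply ex_RInt_mul_laguerre |].
    intros x _; apply Rmult_le_pos; [apply pow2_ge_0 | apply laguerre_ge0]. }
  assert (Hmon : forall a b, a <= b -> laguerre_int f a <= laguerre_int f b).
  { intros a b Hab; rewrite (laguerre_int_Chasles f a b Hp2).
    specialize (Hpos a b Hab); lra. }
  assert (Hlim : forall b, laguerre_int f b <= real (Lim (laguerre_int f) p_infty)).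
  { intros b; apply (is_lim_le_loc (fun _ => laguerre_int f b) (laguerre_int f) p_infty
      (laguerre_int f b) (real (Lim (laguerre_int f) p_infty)));
      [|apply is_lim_const | now apply is_lim_laguerre_int].
    exists b; intros y Hy; apply Hmon; lra. }
  assert (Hconst : forall b, t <= b -> laguerre_int f b = laguerre_int f t).
  { intros b Hb; unfold functional in H0.
    specialize (Hlim b); assert (H1 := Hmon t b Hb).
    assert (H2 : 0 <= laguerre_int f t) by (apply Hpos; lra).
    nra. }
  destruct (monic_poly_nonzero n p t Hp) as [x [Htx Hx]].
  assert (E : f x * laguerre alpha x = 0).
  { rewrite <- (is_derive_unique _ _ _ (is_derive_laguerre_int f x Hp2)).
    apply is_derive_unique, (is_derive_ext_loc (fun _ => laguerre_int f t)).
    - apply (filter_imp (fun y => t < y)); [|now apply open_gt].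
      intros y Hy; symmetry; apply Hconst; lra.
    - apply (is_derive_const (laguerre_int f t)). }
  apply Rmult_integral in E; destruct E as [E|E].
  - now apply (pow_nonzero (p x) 2) in Hx.
  - assert (H := laguerre_gt0 alpha x); lra.
Qed.

End Functional.

(** * Calculus on the diagonal *)

(** The parameter moves both the integrand and the upper limit, but the interval shrinks to a point
    at [s = t]. Joint continuity at [(t, t)] therefore replaces any derivative of [phi] in its
    parameter. *)
Lemma is_derive_RInt_diag (phi : R -> R -> R) (t : R) :
  continuity_2d_pt phi t t ->
  locally t (fun s => ex_RInt (fun x => phi x s) t s) ->
  is_derive (fun s => RInt (fun x => phi x s) t s) t (phi t t).
Proof.
  intros Hphi [d1 Hex]; apply is_derive_Reals; intros eps Heps.
  destruct (Hphi (mkposreal (eps / 2) ltac:(lra))) as [d2 Hd2]; simpl in Hd2.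
  assert (Hd : 0 < Rmin d1 d2) by (apply Rmin_pos; [apply d1 | apply d2]).
  exists (mkposreal _ Hd); intros k Hk Hkd; simpl in Hkd.
  assert (Hk1 := Rlt_le_trans _ _ _ Hkd (Rmin_l d1 d2)).
  assert (Hk2 := Rlt_le_trans _ _ _ Hkd (Rmin_r d1 d2)).
  assert (Hint : ex_RInt (fun x => phi x (t + k)) t (t + k)).
  { apply Hex; unfold ball; simpl; unfold AbsRing_ball, abs, minus, plus, opp; simpl.
    now replace (t + k + - t) with k by ring. }
  assert (Hc : ex_RInt (fun x => phi x (t + k) - phi t t) t (t + k)).
  { apply (ex_RInt_minus (V := R_NormedModule)); [exact Hint | apply ex_RInt_const]. }
  assert (E : RInt (fun x => phi x (t + k) - phi t t) t (t + k)
              = RInt (fun x => phi x (t + k)) t (t + k) - k * phi t t).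
  { etransitivity.
    - apply (RInt_minus (V := R_CompleteNormedModule) (fun x => phi x (t + k))
               (fun _ => phi t t)); [exact Hint | apply ex_RInt_const].
    - rewrite RInt_const; unfold minus, plus, opp, scal; simpl; unfold mult; simpl; ring. }
  assert (Hbound : Rabs (RInt (fun x => phi x (t + k) - phi t t) t (t + k))
                   <= Rabs k * (eps / 2)).
  { assert (Hx : forall x, Rabs (x - t) <= Rabs k -> Rabs (phi x (t + k) - phi t t) <= eps / 2).
    { intros x Hx; apply Rlt_le, Hd2; [lra|].
      now replace (t + k - t) with k by ring. }
    destruct (Rle_dec 0 k) as [Hk0|Hk0].
    - rewrite (Rabs_pos_eq k) in * by exact Hk0.
      replace (k * (eps / 2)) with ((t + k - t) * (eps / 2)) by ring.
      apply abs_RInt_le_const; [lra | exact Hc |].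
      intros x Hxt; apply Hx; rewrite Rabs_pos_eq; lra.
    - rewrite (Rabs_left k) in * by lra.
      rewrite <- (opp_RInt_swap (V := R_CompleteNormedModule)) by now apply ex_RInt_swap.
      unfold opp; simpl; rewrite Rabs_Ropp.
      replace (- k * (eps / 2)) with ((t - (t + k)) * (eps / 2)) by ring.
      apply abs_RInt_le_const; [lra | now apply ex_RInt_swap |].
      intros x Hxt; apply Hx; rewrite Rabs_left1; lra. }
  rewrite RInt_point; unfold zero; simpl; rewrite Rminus_0_r.
  replace (RInt (fun x => phi x (t + k)) t (t + k) / k - phi t t)
    with (RInt (fun x => phi x (t + k) - phi t t) t (t + k) / k)
    by (rewrite E; field; exact Hk).
  unfold Rdiv; rewrite Rabs_mult, Rabs_inv.
  assert (H0 := Rabs_pos_lt k Hk).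
  apply (Rmult_lt_reg_r (Rabs k)); [exact H0|].
  rewrite Rmult_assoc, Rinv_l, Rmult_1_r by lra; nra.
Qed.

Lemma continuity_2d_pt_diag (f : R -> R -> R) t :
  continuity_2d_pt f t t -> continuity_2d_pt (fun _ v => f v v) t t.
Proof.
  intros Hf eps; destruct (Hf eps) as [d Hd]; exists d; intros u v _ Hv.
  now apply Hd.
Qed.

Lemma continuity_2d_pt_fst (f : R -> R) t :
  continuous f t -> continuity_2d_pt (fun u _ => f u) t t.
Proof.
  intros Hf; apply (continuity_1d_2d_pt_comp f (fun u _ => u)).
  - now apply continuity_pt_filterlim.
  - apply continuity_2d_pt_id1.
Qed.

Lemma continuity_2d_pt_snd (f : R -> R) t :
  continuous f t -> continuity_2d_pt (fun _ v => f v) t t.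
Proof.
  intros Hf; apply (continuity_1d_2d_pt_comp f (fun _ v => v)).
  - now apply continuity_pt_filterlim.
  - apply continuity_2d_pt_id2.
Qed.

(** The hypotheses on [P], [h], [a] and [b] speak only of positive parameters; within distance [t]
    of [t] the parameter stays positive. *)
Lemma continuity_2d_pt_ext_pos (f g : R -> R -> R) t :
  0 < t -> (forall u v, 0 < v -> f u v = g u v) ->
  continuity_2d_pt f t t -> continuity_2d_pt g t t.
Proof.
  intros Ht E; apply continuity_2d_pt_ext_loc.
  exists (mkposreal t Ht); simpl; intros u v _ Hv; apply E.
  apply Rabs_lt_between in Hv; lra.
Qed.

(** * Orthogonal polynomials *)

Lemma monic_poly_sub n (p q : R -> R) :
  monic_poly_deg n p -> monic_poly_deg n q ->
  exists r, deg_lt n r /\ forall x, p x = q x + r x.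
Proof.
  intros [c Hp] [c' Hq].
  exists (fun x => psum c n x + (-1) * psum c' n x); split.
  - apply deg_lt_plus; [now exists c|]; apply deg_lt_scal; now exists c'.
  - intros x; rewrite Hp, Hq; ring.
Qed.

Lemma monic_poly_mulX n (p : R -> R) :
  monic_poly_deg n p -> monic_poly_deg (S n) (fun x => x * p x).
Proof.
  intros [c Hp]; destruct (deg_lt_mulX n (psum c n)) as [c' H]; [now exists c|].
  exists c'; intros x; rewrite <- H, Hp; simpl; ring.
Qed.

Lemma monic_poly_pow n : monic_poly_deg n (fun x => x ^ n).
Proof.
  destruct (deg_lt_zero n) as [c Hc]; exists c; intros x; rewrite <- Hc; ring.
Qed.

Lemma monic_poly_deg_lt n (p : R -> R) : monic_poly_deg n p -> deg_lt (S n) p.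
Proof.
  intros [c Hp]; apply (deg_lt_ext _ (fun x => x ^ n + psum c n x)); [now symmetry|].
  apply deg_lt_plus; [apply deg_lt_pow | apply deg_lt_S; now exists c].
Qed.

(** One step of the expansion in a basis of monic polynomials, for inductions on the degree. *)
Lemma deg_lt_S_split d (f p : R -> R) :
  deg_lt (S d) f -> monic_poly_deg d p ->
  exists l q, deg_lt d q /\ forall x, f x = q x + l * p x.
Proof.
  intros [c Hf] [c' Hp].
  exists (c d), (fun x => psum c d x + (- c d) * psum c' d x); split.
  - apply deg_lt_plus; [now exists c|]; apply deg_lt_scal; now exists c'.
  - intros x; rewrite Hf, Hp; simpl; ring.
Qed.

(** The Euler operator [x d/dx] does not raise the degree, and [functional_parts] involves the
    derivative only through it. *)
Lemma deg_lt_mulX_derive d (f : R -> R) :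
  deg_lt d f ->
  exists f', is_poly f' /\ (forall x, is_derive f x (f' x)) /\
    deg_lt d (fun x => x * f' x).
Proof.
  intros Hf; destruct (deg_lt_derive d f Hf) as [f' [Hf' Hd]].
  exists f'; split; [now exists (pred d) | split; [exact Hd |]].
  destruct d as [|d]; [|now apply deg_lt_mulX].
  apply (deg_lt_ext _ (fun _ => 0)); [|apply deg_lt_zero].
  intros x; destruct Hf' as [c Hc]; rewrite Hc; simpl; ring.
Qed.

(** For recurrence coefficients [a], this is minus the coefficient of [x ^ (n - 1)] in [P n] when
    [n >= 1]; see [P_subleading]. *)
Fixpoint partial_sum (a : nat -> R -> R) (n : nat) (t : R) : R :=
  match n with O => 0 | S m => partial_sum a m t + a m t end.

Section OrthogonalPolynomials.

Variables (alpha A B : R) (P : nat -> R -> R -> R) (h a b : nat -> R -> R).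
Hypotheses (Halpha : 0 < alpha) (HA : 0 <= A) (HB : 0 < B).
Hypotheses (HP : monic_OPS alpha A B P h) (Hrec : three_term P a b).

Lemma P_monic t n : 0 < t -> monic_poly_deg n (fun x => P n x t).
Proof. intros Ht; destruct (HP t Ht) as [Hm _]; exact (Hm n). Qed.

Lemma P_is_poly t n : 0 < t -> is_poly (fun x => P n x t).
Proof. intros Ht; now apply (monic_poly_is_poly n), P_monic. Qed.

Lemma P_0 t x : 0 < t -> P 0 x t = 1.
Proof. intros Ht; destruct (P_monic t 0 Ht) as [c Hc]; rewrite Hc; simpl; ring. Qed.

(* [P 0 = 1], so orthogonality to [P 0] already contains the convergence of the integral
   of every [P n]. *)
Lemma monic_OPS_moments_finite : moments_finite alpha.
Proof.
  (* [laguerre_int] does not involve the jump position, so convergence is read off at the single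
     parameter value 1. *)
  assert (H1 : 0 < 1) by lra.
  assert (HPn : forall n, ex_finite_lim (laguerre_int alpha (fun x => P n x 1)) p_infty).
  { intros n; destruct (HP 1 H1) as [_ [Hort Hsq]].
    assert (exists v, int_0_infty (fun x => P n x 1 * weight alpha A B 1 x) v)
      as [v Hv].
    { destruct n as [|n].
      - exists (h 0 1); generalize (Hsq 0%nat); unfold int_0_infty.
        apply is_RInt_gen_ext, filter_forall; intros ab x _.
        rewrite P_0 by exact H1; simpl; ring.
      - exists 0; generalize (Hort (S n) 0%nat (Nat.neq_succ_0 n)); unfold int_0_infty.
        apply is_RInt_gen_ext, filter_forall; intros ab x _.
        rewrite (P_0 1 x H1); simpl; ring. }
    eexists; apply (int_0_infty_laguerre_int alpha A B Halpha HA HB 1);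
      [now apply P_is_poly | exact H1 | exact Hv]. }
  intros f [d Hf]; revert f Hf; induction d as [|d IH]; intros f Hf.
  - exists 0; apply (is_lim_ext (fun _ => 0)); [|apply is_lim_const].
    intros y; destruct Hf as [c Hc]; unfold laguerre_int.
    rewrite (RInt_ext _ (fun _ => 0)).
    + rewrite RInt_const; unfold scal; simpl; unfold mult; simpl; ring.
    + intros x _; rewrite Hc; simpl; ring.
  - destruct (deg_lt_S_split d f (fun x => P d x 1) Hf (P_monic 1 d H1))
      as [l [q [Hq E]]].
    destruct (IH q Hq) as [v Hv]; destruct (HPn d) as [u Hu].
    exists (v + l * u).
    apply (is_lim_ext (fun y => laguerre_int alpha q y
                                + l * laguerre_int alpha (fun x => P d x 1) y)).
    + intros y; rewrite (laguerre_int_ext alpha f (fun x => q x + l * P d x 1)) by exact E.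
      assert (Hp := P_is_poly 1 d H1).
      rewrite laguerre_int_plus, laguerre_int_scal; auto using is_poly_scal.
      now exists d.
    + apply is_lim_plus'; [exact Hv|].
      change (Finite (l * u)) with (Rbar_mult l u); now apply is_lim_scal_l.
Qed.

Notation L := (functional alpha A B).

Let Hmom := monic_OPS_moments_finite.

Lemma functional_lin t p f g l :
  is_poly p -> is_poly f -> is_poly g ->
  L t (fun x => p x * (f x + l * g x))
  = L t (fun x => p x * f x) + l * L t (fun x => p x * g x).
Proof.
  intros Hp Hf Hg.
  rewrite (functional_ext _ _ _ t _ (fun x => p x * f x + l * (p x * g x)))
    by (intros x; ring).
  rewrite functional_plus, functional_scal;
    auto using is_poly_scal, is_poly_mult.
Qed.

Lemma functional_P_P t m n : 0 < t -> m <> n -> L t (fun x => P m x t * P n x t) = 0.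
Proof.
  intros Ht Hmn; apply int_0_infty_functional; auto.
  - apply is_poly_mult; now apply P_is_poly.
  - destruct (HP t Ht) as [_ [Hort _]]; exact (Hort m n Hmn).
Qed.

Lemma functional_P_sq t n : 0 < t -> L t (fun x => P n x t ^ 2) = h n t.
Proof.
  intros Ht; apply int_0_infty_functional; auto;
    [|destruct (HP t Ht) as [_ [_ Hsq]]; exact (Hsq n)].
  apply (is_poly_ext (fun x => P n x t * P n x t)); [intros x; ring|].
  apply is_poly_mult; now apply P_is_poly.
Qed.

Lemma h_neq0 t n : 0 < t -> h n t <> 0.
Proof.
  intros Ht; rewrite <- functional_P_sq by exact Ht.
  apply (functional_sq_neq0 alpha A B Halpha HA HB Hmom t n); [exact Ht|].
  now apply P_monic.
Qed.

Lemma functional_P_deg_lt t n q :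
  0 < t -> deg_lt n q -> L t (fun x => P n x t * q x) = 0.
Proof.
  intros Ht Hq.
  enough (H : forall d q, (d <= n)%nat -> deg_lt d q -> L t (fun x => P n x t * q x) = 0)
    by now apply (H n).
  clear q Hq; induction d as [|d IH]; intros q Hd Hq.
  - rewrite (functional_ext _ _ _ t _ (fun x => 0 * P n x t)).
    + rewrite functional_scal by auto using P_is_poly; ring.
    + intros x; destruct Hq as [c Hc]; rewrite Hc; simpl; ring.
  - destruct (deg_lt_S_split d q (fun x => P d x t) Hq (P_monic t d Ht))
      as [l [q' [Hq' E]]].
    rewrite (functional_ext _ _ _ t _ (fun x => P n x t * (q' x + l * P d x t)))
      by (intros x; now rewrite E).
    rewrite functional_lin by (auto using P_is_poly; now exists d).
    rewrite IH, functional_P_P by (auto; lia); ring.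
Qed.

(** Only the leading term of [q] survives orthogonality. Later [q] is [x ^ n], [x * P (n - 1)], or
    [P n] at another parameter value. *)
Lemma functional_P_monic t n q :
  0 < t -> monic_poly_deg n q -> L t (fun x => P n x t * q x) = h n t.
Proof.
  intros Ht Hq.
  destruct (monic_poly_sub n q (fun x => P n x t) Hq (P_monic t n Ht)) as [r [Hr E]].
  rewrite (functional_ext _ _ _ t _ (fun x => P n x t * (P n x t + 1 * r x)))
    by (intros x; rewrite E; ring).
  rewrite functional_lin by (auto using P_is_poly; now exists n).
  rewrite (functional_P_deg_lt t n r) by assumption.
  rewrite (functional_ext _ _ _ t _ (fun x => P n x t ^ 2)) by (intros x; ring).
  rewrite functional_P_sq by exact Ht; ring.
Qed.

(** Each use of the recurrence multiplies by [x - a n t], which lowers the second coefficient by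
    [a n t]; the [b] term has too low a degree to matter. *)
Lemma P_subleading t n :
  0 < t ->
  exists q, deg_lt n q /\
    forall x, P (S n) x t = x ^ S n - partial_sum a (S n) t * x ^ n + q x.
Proof.
  intros Ht; induction n as [|n [q [Hq E]]].
  - exists (fun _ => 0); split; [apply deg_lt_zero|].
    intros x; generalize (Hrec t Ht 0%nat x); rewrite P_0 by exact Ht.
    simpl; intros H; lra.
  - exists (fun x => x * q x + ((a (S n) t * partial_sum a (S n) t) * x ^ n
             + ((- a (S n) t) * q x + (- b (S n) t) * P n x t))); split.
    + apply deg_lt_plus; [now apply deg_lt_mulX|].
      apply deg_lt_plus; [apply deg_lt_scal, deg_lt_pow|].
      apply deg_lt_plus; apply deg_lt_scal; [now apply deg_lt_S|].
      now apply monic_poly_deg_lt, P_monic.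
    + intros x; generalize (Hrec t Ht (S n) x); rewrite (E x); intros H.
      replace (P (S (S n)) x t) with
        (x * (x ^ S n - partial_sum a (S n) t * x ^ n + q x)
         - a (S n) t * (x ^ S n - partial_sum a (S n) t * x ^ n + q x)
         - b (S n) t * P n x t) by lra.
      simpl; ring.
Qed.

(** The Euler operator multiplies [x ^ k] by [k]. Subtracting [n + 1] times the polynomial kills the
    leading term and leaves the second coefficient with factor [n - (n + 1) = - 1]. *)
Lemma P_derive t n :
  0 < t ->
  exists p' q, is_poly p' /\ deg_lt n q /\
    (forall x, is_derive (fun y => P (S n) y t) x (p' x)) /\
    forall x, x * p' x
      = INR (S n) * P (S n) x t + partial_sum a (S n) t * x ^ n + q x.
Proof.
  intros Ht; destruct (P_subleading t n Ht) as [q [Hq E]].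
  destruct (deg_lt_mulX_derive n q Hq) as [q' [Hq' [Hd Hxq']]].
  set (s := partial_sum a (S n) t) in *.
  (* For [n = 0] the default [pred 0 = 0] is harmless, as that term carries the factor [INR 0]. *)
  exists (fun x => INR (S n) * x ^ n + ((- s * INR n) * x ^ pred n + q' x)),
    (fun x => x * q' x + (- INR (S n)) * q x).
  split; [|split; [|split]].
  - apply is_poly_plus; [apply is_poly_scal, is_poly_pow|].
    apply is_poly_plus; [apply is_poly_scal, is_poly_pow | exact Hq'].
  - apply deg_lt_plus; [exact Hxq' | now apply deg_lt_scal].
  - intros x; apply (is_derive_ext (fun y => y ^ S n + (- s * y ^ n + q y))).
    { intros y; simpl; rewrite E; simpl; ring. }
    apply (is_derive_plus (V := R_NormedModule)).
    + auto_derive; [exact I|]. change (1 * (INR (S n) * x ^ n) = INR (S n) * x ^ n); ring.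
    + apply (is_derive_plus (V := R_NormedModule)); [|apply Hd].
      auto_derive; [exact I | ring].
  - intros x; rewrite E, S_INR; destruct n as [|n]; [simpl; ring|].
    rewrite S_INR; simpl pred; simpl pow; ring.
Qed.

(** * Recurrence coefficients from orthogonality and integration by parts *)

Definition jump_R (n : nat) (t : R) : R := B * laguerre alpha t * P n t t ^ 2 / h n t.

(* Indices are shifted by one, to avoid [P (n - 1)]: [jump_r n] and [norm_ratio n] are
   [r_(n+1)] and [beta_(n+1)]. *)
Definition jump_r (n : nat) (t : R) : R :=
  B * laguerre alpha t * P (S n) t t * P n t t / h n t.

Definition norm_ratio (n : nat) (t : R) : R := h (S n) t / h n t.

Lemma functional_mulX_P t n :
  0 < t -> L t (fun x => P n x t * (x * P n x t)) = a n t * h n t.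
Proof.
  intros Ht.
  assert (exists q, deg_lt n q /\ forall x, x * P n x t = P (S n) x t + a n t * P n x t + q x)
    as [q [Hq E]].
  { destruct n as [|n].
    - exists (fun _ => 0); split; [apply deg_lt_zero | apply (Hrec t Ht)].
    - exists (fun x => b (S n) t * P n x t); split; [|apply (Hrec t Ht)].
      now apply deg_lt_scal, monic_poly_deg_lt, P_monic. }
  rewrite (functional_ext _ _ _ t _
             (fun x => P n x t * ((P (S n) x t + a n t * P n x t) + 1 * q x)))
    by (intros x; rewrite E; ring).
  assert (HPn := P_is_poly t n Ht); assert (HPn' := P_is_poly t (S n) Ht).
  rewrite functional_lin, functional_lin; auto using is_poly_plus, is_poly_scal;
    [|now exists n].
  rewrite (functional_P_P t n (S n)), (functional_P_deg_lt t n q) by auto.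
  rewrite functional_P_monic by auto using P_monic; ring.
Qed.

(** The pairing of [P (S n)] with [x * P n] is computed twice: it is [h (S n)] because [x * P n] is
    monic, and moving [x] to the other factor by the recurrence gives [b (S n) * h n]. *)
Lemma recurrence_b t n : 0 < t -> b (S n) t = norm_ratio n t.
Proof.
  intros Ht; apply (Rmult_eq_reg_r (h n t)); [|now apply h_neq0].
  unfold norm_ratio; field_simplify; [|now apply h_neq0].
  rewrite <- (functional_P_monic t (S n) (fun x => x * P n x t))
    by auto using monic_poly_mulX, P_monic.
  rewrite (functional_ext _ _ _ t _
     (fun x => P n x t * ((P (S (S n)) x t + a (S n) t * P (S n) x t) + b (S n) t * P n x t)))
    by (intros x; rewrite <- (Hrec t Ht (S n)); ring).
  assert (H0 := P_is_poly t n Ht); assert (H1 := P_is_poly t (S n) Ht).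
  assert (H2 := P_is_poly t (S (S n)) Ht).
  rewrite functional_lin, functional_lin; auto using is_poly_plus, is_poly_scal.
  rewrite (functional_P_P t n (S (S n))), (functional_P_P t n (S n)) by (auto; lia).
  rewrite functional_P_monic by auto using P_monic; ring.
Qed.

(** In [functional_parts] for [P n ^ 2], orthogonality keeps only the part [n * P n] of [x * P n'],
    and the factor [- x] produces [- a n * h n]. *)
Lemma recurrence_a t n :
  0 < t -> a n t = 2 * INR n + 1 + alpha + t * jump_R n t.
Proof.
  intros Ht.
  assert (exists p' q, is_poly p' /\ deg_lt n q /\
    (forall x, is_derive (fun y => P n y t) x (p' x)) /\
    forall x, x * p' x = INR n * P n x t + q x) as [p' [q [Hp' [Hq [Hd E]]]]].
  { destruct n as [|n].
    - exists (fun _ => 0), (fun _ => 0).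
      split; [apply is_poly_const | split; [apply deg_lt_zero | split]].
      + intros x; apply (is_derive_ext (fun _ => 1)); [intros y; now rewrite P_0|].
        apply (is_derive_const 1).
      + intros x; simpl; ring.
    - destruct (P_derive t n Ht) as [p' [q [Hp' [Hq [Hd E]]]]].
      exists p', (fun x => partial_sum a (S n) t * x ^ n + q x).
      split; [exact Hp' | split; [|split; [exact Hd | intros x; rewrite E; ring]]].
      apply deg_lt_plus; [apply deg_lt_scal, deg_lt_pow | now apply deg_lt_S]. }
  assert (HPn := P_is_poly t n Ht).
  assert (Hxp : is_poly (fun x => x * p' x)) by now apply is_poly_mulX.
  assert (H := functional_parts alpha A B Halpha Hmom t
    (fun x => P n x t * P n x t) (fun x => p' x * P n x t + P n x t * p' x)).
  rewrite (functional_ext _ _ _ t _ (fun x => P n x t *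
     (((2 * (x * p' x)) + (alpha + 1) * P n x t) + (-1) * (x * P n x t)))) in H
    by (intros x; ring).
  rewrite 2 functional_lin in H;
    auto using is_poly_plus, is_poly_scal, is_poly_mulX.
  rewrite (functional_ext _ _ _ t (fun x => P n x t * (2 * (x * p' x)))
            (fun x => P n x t * ((2 * INR n) * P n x t + 2 * q x))) in H
    by (intros x; rewrite E; ring).
  rewrite functional_lin in H; auto using is_poly_scal; [|now exists n].
  rewrite (functional_P_deg_lt t n q) in H by auto.
  rewrite (functional_ext _ _ _ t (fun x => P n x t * (2 * INR n * P n x t))
            (fun x => (2 * INR n) * (P n x t * P n x t))) in H by (intros x; ring).
  rewrite functional_scal in H; auto using is_poly_mult.
  rewrite functional_mulX_P in H by exact Ht.
  rewrite (functional_P_monic t n) in H by auto using P_monic.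
  assert (Hh := h_neq0 t n Ht); unfold jump_R.
  apply (Rmult_eq_reg_r (h n t)); [|exact Hh].
  field_simplify; [|exact Hh].
  enough (2 * INR n * h n t + 2 * 0 + (alpha + 1) * h n t + -1 * (a n t * h n t)
          = - (B * laguerre alpha t) * t * (P n t t * P n t t)) by lra.
  apply H; try (apply is_poly_mult || apply is_poly_plus); auto using is_poly_mult.
  intros x; evar_last.
  - apply (is_derive_mult (fun y => P n y t) (fun y => P n y t)); auto.
    exact Rmult_comm.
  - reflexivity.
Qed.

(** In [functional_parts] for [P (S n) * P n], the derivative of [P (S n)] contributes the
    subleading term [s * h n], that of [P n] contributes 0, and the factor [- x] gives
    [- h (S n)]. *)
Lemma partial_sum_a t n :
  0 < t -> partial_sum a (S n) t = norm_ratio n t - t * jump_r n t.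
Proof.
  intros Ht; destruct (P_derive t n Ht) as [p' [q [Hp' [Hq [Hd E]]]]].
  assert (Hn := P_is_poly t n Ht); assert (HSn := P_is_poly t (S n) Ht).
  destruct (deg_lt_mulX_derive (S n) (fun x => P n x t)) as [p0 [Hp0 [Hd0 Hxp0]]];
    [now apply monic_poly_deg_lt, P_monic|].
  set (s := partial_sum a (S n) t) in *.
  assert (Hqp : is_poly q) by now exists n.
  assert (H := functional_parts alpha A B Halpha Hmom t
    (fun x => P (S n) x t * P n x t) (fun x => p' x * P n x t + P (S n) x t * p0 x)).
  rewrite (functional_ext _ _ _ t _ (fun x =>
     P n x t * (INR (S n) * P (S n) x t + s * x ^ n + 1 * q x)
     + P (S n) x t * (((x * p0 x) + (alpha + 1) * P n x t) + (-1) * (x * P n x t)))) in H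
    by (intros x; rewrite Rmult_1_l, <- (E x); ring).
  rewrite functional_plus in H;
    auto 8 using is_poly_plus, is_poly_scal, is_poly_mulX, is_poly_pow, is_poly_mult.
  rewrite 4 functional_lin in H;
    auto 8 using is_poly_plus, is_poly_scal, is_poly_mulX, is_poly_pow.
  rewrite (functional_ext _ _ _ t (fun x => P n x t * (INR (S n) * P (S n) x t))
             (fun x => INR (S n) * (P n x t * P (S n) x t))) in H by (intros x; ring).
  rewrite functional_scal, (functional_P_P t n (S n)), (functional_P_P t (S n) n) in H;
    auto using is_poly_mult.
  rewrite (functional_P_deg_lt t n q), (functional_P_deg_lt t (S n)) in H by auto.
  rewrite functional_P_monic, functional_P_monic in H;
    auto using monic_poly_mulX, monic_poly_pow, P_monic.
  - assert (Hh := h_neq0 t n Ht); unfold jump_r, norm_ratio.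
    apply (Rmult_eq_reg_r (h n t)); [|exact Hh].
    field_simplify; [|exact Hh].
    enough (INR (S n) * 0 + s * h n t + 1 * 0 + (0 + (alpha + 1) * 0 + -1 * h (S n) t)
            = - (B * laguerre alpha t) * t * (P (S n) t t * P n t t)) by lra.
    apply H; auto using is_poly_mult, is_poly_plus.
    intros x; evar_last.
    + apply (is_derive_mult (fun y => P (S n) y t) (fun y => P n y t)); auto.
      exact Rmult_comm.
    + reflexivity.
Qed.

(** * Algebraic relations from the recurrence on the diagonal *)

Lemma P_diag_SS t n :
  0 < t -> P (S (S n)) t t = (t - a (S n) t) * P (S n) t t - norm_ratio n t * P n t t.
Proof.
  intros Ht; generalize (Hrec t Ht (S n) t); rewrite recurrence_b by exact Ht; lra.
Qed.

Lemma P_diag_1 t : 0 < t -> P 1 t t = t - a 0 t.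
Proof.
  intros Ht; generalize (Hrec t Ht 0%nat t); rewrite P_0 by exact Ht; lra.
Qed.

Lemma jump_r_0 t : 0 < t -> jump_r 0 t = (t - a 0 t) * jump_R 0 t.
Proof.
  intros Ht; unfold jump_r, jump_R; rewrite P_diag_1, P_0 by exact Ht.
  field; now apply h_neq0.
Qed.

(** The recurrence at [x = t], multiplied by [B * laguerre alpha t * P (S n) t t / h (S n) t]. *)
Lemma jump_r_succ_add t n :
  0 < t -> jump_r (S n) t + jump_r n t = (t - a (S n) t) * jump_R (S n) t.
Proof.
  intros Ht; unfold jump_r, jump_R; rewrite P_diag_SS by exact Ht; unfold norm_ratio.
  field; repeat split; now apply h_neq0.
Qed.

Lemma jump_r_sq t n : 0 < t -> jump_r n t ^ 2 = norm_ratio n t * jump_R (S n) t * jump_R n t.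
Proof.
  intros Ht; unfold jump_r, jump_R, norm_ratio; field; repeat split; now apply h_neq0.
Qed.

(* Telescoping in [n]: by the recurrence
   [beta_(n+1) R_(n+1) - beta_n R_(n-1) = (r_(n+1) - r_n) (t - alpha_n)]. *)
Lemma norm_ratio_jump_identity t n :
  0 < t ->
  norm_ratio n t * (1 - jump_R (S n) t - jump_R n t)
  = (INR n + 1) * (INR n + 1 + alpha) + (2 * (INR n + 1) + alpha) * jump_r n t.
Proof.
  intros Ht; induction n as [|n IH].
  - assert (H0 := recurrence_a t 0 Ht); assert (H1 := partial_sum_a t 0 Ht).
    assert (E : norm_ratio 0 t * jump_R 1 t = (t - a 0 t) * jump_r 0 t).
    { unfold norm_ratio, jump_R, jump_r; rewrite P_diag_1, P_0 by exact Ht.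
      field; repeat split; now apply h_neq0. }
    rewrite jump_r_0 in * by exact Ht; simpl in H0, H1 |- *.
    replace (norm_ratio 0 t * (1 - jump_R 1 t - jump_R 0 t))
      with (norm_ratio 0 t * (1 - jump_R 0 t) - norm_ratio 0 t * jump_R 1 t) by ring.
    rewrite E; replace (norm_ratio 0 t) with (a 0 t + t * ((t - a 0 t) * jump_R 0 t)) by lra.
    rewrite H0; ring.
  - assert (Ha := recurrence_a t (S n) Ht); rewrite S_INR in Ha |- *.
    assert (H1 := partial_sum_a t n Ht); assert (H2 := partial_sum_a t (S n) Ht).
    change (partial_sum a (S (S n)) t) with (partial_sum a (S n) t + a (S n) t) in H2.
    assert (Hadd := jump_r_succ_add t n Ht).
    (* A difference of squares: with [u = P (S (S n)) t t] and [v = norm_ratio n t * P n t t], the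
       recurrence evaluates [u + v], while [u - v] gives the difference of the [jump_r]. *)
    assert (E : norm_ratio (S n) t * jump_R (S (S n)) t
                = norm_ratio n t * jump_R n t + (jump_r (S n) t - jump_r n t) * (t - a (S n) t)).
    { unfold norm_ratio, jump_R, jump_r; rewrite P_diag_SS by exact Ht; unfold norm_ratio.
      field; repeat split; now apply h_neq0. }
    replace (norm_ratio (S n) t * (1 - jump_R (S (S n)) t - jump_R (S n) t))
      with (norm_ratio (S n) t * (1 - jump_R (S n) t)
            - norm_ratio (S n) t * jump_R (S (S n)) t) by ring.
    rewrite E.
    (* This is the difference of [partial_sum_a] at two consecutive indices. *)
    replace (norm_ratio (S n) t)
      with (norm_ratio n t + a (S n) t + t * (jump_r (S n) t - jump_r n t)) by lra.
    replace (jump_r (S n) t) with ((t - a (S n) t) * jump_R (S n) t - jump_r n t) by lra.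
    (* The regrouping isolates the left side of the induction hypothesis; the remainder no longer
       contains [norm_ratio]. *)
    replace ((norm_ratio n t + a (S n) t
              + t * ((t - a (S n) t) * jump_R (S n) t - jump_r n t - jump_r n t))
               * (1 - jump_R (S n) t)
       - (norm_ratio n t * jump_R n t
          + ((t - a (S n) t) * jump_R (S n) t - jump_r n t - jump_r n t) * (t - a (S n) t)))
      with (norm_ratio n t * (1 - jump_R (S n) t - jump_R n t)
       + ((a (S n) t + t * ((t - a (S n) t) * jump_R (S n) t - jump_r n t - jump_r n t))
            * (1 - jump_R (S n) t)
          - ((t - a (S n) t) * jump_R (S n) t - jump_r n t - jump_r n t)
            * (t - a (S n) t))) by ring.
    rewrite IH, Ha; ring.
Qed.

(** * Differentiation with respect to the jump position *)

Lemma functional_diff s t m n :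
  0 < s -> 0 < t ->
  L s (fun x => P m x s * P n x t) - L t (fun x => P m x s * P n x t)
  = - B * RInt (fun x => P m x s * P n x t * laguerre alpha x) t s.
Proof.
  intros Hs Ht; apply (functional_sub alpha A B Halpha s t (fun x => P m x s * P n x t)).
  apply is_poly_mult; now apply P_is_poly.
Qed.

(* [h_n(t)] and [h_n(s)] are the values of the two functionals on the same product
   [P_n(.,s) P_n(.,t)], so no derivative of the coefficients of [P_n] is needed. *)
Lemma h_diff s t n :
  0 < s -> 0 < t ->
  h n s = h n t + - B * RInt (fun x => P n x s * P n x t * laguerre alpha x) t s.
Proof.
  intros Hs Ht; rewrite <- functional_diff by assumption.
  rewrite (functional_P_monic s n (fun x => P n x t)) by auto using P_monic.
  rewrite (functional_ext _ _ _ t _ (fun x => P n x t * P n x s)) by (intros x; ring).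
  rewrite (functional_P_monic t n) by auto using P_monic; ring.
Qed.

(** The product [P (S n)(., s) * P n(., t)] has functional 0 at [s] by degree. At [t] only the
    difference of the two subleading coefficients survives, times [h n t]. *)
Lemma partial_sum_a_diff s t n :
  0 < s -> 0 < t ->
  partial_sum a (S n) s = partial_sum a (S n) t
    + - (B / h n t) * RInt (fun x => P (S n) x s * P n x t * laguerre alpha x) t s.
Proof.
  intros Hs Ht; assert (Hh := h_neq0 t n Ht).
  assert (H := functional_diff s t (S n) n Hs Ht).
  rewrite (functional_P_deg_lt s (S n) (fun x => P n x t)) in H
    by auto using monic_poly_deg_lt, P_monic.
  destruct (P_subleading s n Hs) as [qs [Hqs Es]].
  destruct (P_subleading t n Ht) as [qt [Hqt Et]].
  rewrite (functional_ext _ _ _ t _ (fun x => P n x t *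
     ((P (S n) x t + (partial_sum a (S n) t - partial_sum a (S n) s) * x ^ n)
       + 1 * (qs x + (-1) * qt x)))) in H
    by (intros x; rewrite Es, Et; ring).
  assert (Hn := P_is_poly t n Ht); assert (HSn := P_is_poly t (S n) Ht).
  assert (Hq : deg_lt n (fun x => qs x + (-1) * qt x))
    by auto using deg_lt_plus, deg_lt_scal.
  rewrite functional_lin, functional_lin in H;
    auto using is_poly_plus, is_poly_scal, is_poly_pow; [|now exists n].
  rewrite (functional_P_P t n (S n)), (functional_P_deg_lt t n _ Ht Hq) in H by auto.
  rewrite (functional_P_monic t n) in H by auto using monic_poly_pow.
  apply (Rmult_eq_reg_r (h n t)); [|exact Hh].
  field_simplify; [|exact Hh]; lra.
Qed.

Lemma is_derive_P_diag t m n :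
  0 < t -> continuity_2d_pt (P m) t t ->
  is_derive (fun s => RInt (fun x => P m x s * P n x t * laguerre alpha x) t s) t
    (P m t t * P n t t * laguerre alpha t).
Proof.
  intros Ht Hc.
  apply (is_derive_RInt_diag (fun x s => P m x s * P n x t * laguerre alpha x)).
  - apply continuity_2d_pt_mult; [apply continuity_2d_pt_mult|].
    + exact Hc.
    + apply (continuity_2d_pt_fst (fun x => P n x t)).
      now apply is_poly_continuous, P_is_poly.
    + apply continuity_2d_pt_fst; now apply continuous_laguerre.
  - apply (filter_imp (fun s => 0 < s)); [|now apply open_gt].
    intros s Hs; apply ex_RInt_mul_laguerre; [exact Halpha|].
    apply is_poly_mult; now apply P_is_poly.
Qed.

(** Continuity of [P n] in the parameter is a premise here because it is itself derived, degree by
    degree, from this lemma. *)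
Lemma is_derive_h_of_continuity t n :
  0 < t -> continuity_2d_pt (P n) t t -> is_derive (h n) t (- jump_R n t * h n t).
Proof.
  intros Ht Hc; apply (is_derive_ext_loc (fun s => h n t
    + - B * RInt (fun x => P n x s * P n x t * laguerre alpha x) t s)).
  - apply (filter_imp (fun s => 0 < s)); [|now apply open_gt].
    intros s Hs; symmetry; now apply h_diff.
  - replace (- jump_R n t * h n t) with (0 + - B * (P n t t * P n t t * laguerre alpha t))
      by (unfold jump_R; field; now apply h_neq0).
    apply (is_derive_plus (V := R_NormedModule)); [apply (is_derive_const (h n t))|].
    apply (is_derive_scal _ t (- B)); now apply is_derive_P_diag.
Qed.

Lemma continuity_a_of_P t n :
  0 < t -> continuity_2d_pt (P n) t t -> continuity_2d_pt (fun _ v => a n v) t t.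
Proof.
  intros Ht Hc; apply (continuity_2d_pt_ext_pos (fun _ v =>
    2 * INR n + 1 + alpha
    + v * (B * laguerre alpha v * (P n v v * P n v v) * / h n v))); [exact Ht| |].
  { intros _ v Hv; rewrite recurrence_a by exact Hv; unfold jump_R; field; now apply h_neq0. }
  apply continuity_2d_pt_plus; [apply continuity_2d_pt_const|].
  apply continuity_2d_pt_mult; [apply continuity_2d_pt_id2|].
  apply continuity_2d_pt_mult; [apply continuity_2d_pt_mult|].
  - apply continuity_2d_pt_mult; [apply continuity_2d_pt_const|].
    apply continuity_2d_pt_snd; now apply continuous_laguerre.
  - apply continuity_2d_pt_mult; now apply continuity_2d_pt_diag.
  - apply continuity_2d_pt_inv; [|now apply h_neq0].
    apply continuity_2d_pt_snd, (ex_derive_continuous (V := R_NormedModule)).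
    eexists; now apply is_derive_h_of_continuity.
Qed.

(** A bootstrap: continuity of [P n] makes [h n] differentiable, hence [a n] continuous by
    [recurrence_a], and the recurrence passes continuity to the next degree. Two consecutive degrees
    are carried since the recurrence has order two. *)
Lemma continuity_P t n : 0 < t -> continuity_2d_pt (P n) t t.
Proof.
  intros Ht; enough (H : continuity_2d_pt (P n) t t /\ continuity_2d_pt (P (S n)) t t)
    by apply H.
  induction n as [|n [Hn HSn]].
  - assert (H0 : continuity_2d_pt (P 0) t t).
    { apply (continuity_2d_pt_ext_pos (fun _ _ => 1)); [exact Ht| |].
      - intros u v Hv; now rewrite P_0.
      - apply continuity_2d_pt_const. }
    split; [exact H0|].
    apply (continuity_2d_pt_ext_pos (fun u v => u - a 0 v)); [exact Ht| |].
    + intros u v Hv; generalize (Hrec v Hv 0%nat u); rewrite P_0 by exact Hv; lra.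
    + apply continuity_2d_pt_minus; [apply continuity_2d_pt_id1|].
      now apply continuity_a_of_P.
  - split; [exact HSn|].
    apply (continuity_2d_pt_ext_pos (fun u v => u * P (S n) u v - a (S n) v * P (S n) u v
             - h (S n) v * / h n v * P n u v)); [exact Ht| |].
    + intros u v Hv; generalize (Hrec v Hv (S n) u); rewrite recurrence_b by exact Hv.
      unfold norm_ratio, Rdiv; lra.
    + assert (Hh : forall k, continuity_2d_pt (P k) t t ->
                     continuity_2d_pt (fun _ v => h k v) t t).
      { intros k Hk; apply continuity_2d_pt_snd.
        apply (ex_derive_continuous (V := R_NormedModule)).
        eexists; now apply is_derive_h_of_continuity. }
      apply continuity_2d_pt_minus; [apply continuity_2d_pt_minus|];
        apply continuity_2d_pt_mult; auto using continuity_2d_pt_id1, continuity_a_of_P.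
      apply continuity_2d_pt_mult; [|apply continuity_2d_pt_inv]; auto using h_neq0.
Qed.

Lemma is_derive_h t n : 0 < t -> is_derive (h n) t (- jump_R n t * h n t).
Proof. intros Ht; apply is_derive_h_of_continuity; auto using continuity_P. Qed.

Lemma is_derive_partial_sum_a t n :
  0 < t -> is_derive (partial_sum a (S n)) t (- jump_r n t).
Proof.
  intros Ht; apply (is_derive_ext_loc (fun s => partial_sum a (S n) t
    + - (B / h n t) * RInt (fun x => P (S n) x s * P n x t * laguerre alpha x) t s)).
  - apply (filter_imp (fun s => 0 < s)); [|now apply open_gt].
    intros s Hs; symmetry; now apply partial_sum_a_diff.
  - replace (- jump_r n t)
      with (0 + - (B / h n t) * (P (S n) t t * P n t t * laguerre alpha t))
      by (unfold jump_r; field; now apply h_neq0).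
    apply (is_derive_plus (V := R_NormedModule));
      [apply (is_derive_const (partial_sum a (S n) t))|].
    apply (is_derive_scal _ t (- (B / h n t))).
    apply is_derive_P_diag; auto using continuity_P.
Qed.

Lemma is_derive_norm_ratio t n :
  0 < t -> is_derive (norm_ratio n) t (norm_ratio n t * (jump_R n t - jump_R (S n) t)).
Proof.
  intros Ht; assert (Hh := h_neq0 t n Ht).
  assert (H0 := is_derive_h t n Ht); assert (H1 := is_derive_h t (S n) Ht).
  evar_last; [exact (is_derive_div (h (S n)) (h n) t _ _ H1 H0 Hh)|].
  unfold norm_ratio; field; exact Hh.
Qed.

(** [partial_sum_a] is solved for [jump_r], so no derivative of [P] occurs. In the quotient rule the
    two terms [jump_r n t / t] cancel. *)
Lemma is_derive_jump_r t n :
  0 < t -> is_derive (jump_r n) t (norm_ratio n t * (jump_R n t - jump_R (S n) t) / t).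
Proof.
  intros Ht; apply (is_derive_ext_loc (fun s => (norm_ratio n s - partial_sum a (S n) s) / s)).
  - apply (filter_imp (fun s => 0 < s)); [|now apply open_gt].
    intros s Hs; change ((norm_ratio n s - partial_sum a (S n) s) / s = jump_r n s).
    rewrite partial_sum_a by exact Hs; field.
    apply Rgt_not_eq, Hs.
  - assert (Hb := is_derive_norm_ratio t n Ht); assert (Hs := is_derive_partial_sum_a t n Ht).
    evar_last.
    + apply (is_derive_div (fun s => norm_ratio n s - partial_sum a (S n) s) (fun s => s) t).
      * exact (is_derive_minus (V := R_NormedModule) _ _ _ _ _ Hb Hs).
      * apply (is_derive_id t).
      * lra.
    + rewrite partial_sum_a by exact Ht; unfold minus, plus, opp, one; simpl.
      field; lra.
Qed.

(** By [recurrence_a], [t * jump_R] is [a] up to a constant, and [a] is a difference of partial sums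
    with known derivatives. [jump_r_succ_add] then removes [jump_r (S n)]. *)
Lemma is_derive_jump_R_S t n :
  0 < t ->
  is_derive (jump_R (S n)) t
    ((2 * jump_r n t + (2 * (INR n + 1) + alpha) * jump_R (S n) t
      - t * jump_R (S n) t * (1 - jump_R (S n) t)) / t).
Proof.
  intros Ht; apply (is_derive_ext_loc (fun s =>
    (partial_sum a (S (S n)) s - partial_sum a (S n) s
     - (2 * INR (S n) + 1 + alpha)) / s)).
  - apply (filter_imp (fun s => 0 < s)); [|now apply open_gt].
    intros s Hs.
    change ((partial_sum a (S n) s + a (S n) s - partial_sum a (S n) s
             - (2 * INR (S n) + 1 + alpha)) / s = jump_R (S n) s).
    rewrite recurrence_a by exact Hs; field; apply Rgt_not_eq, Hs.
  - assert (H2 := is_derive_partial_sum_a t (S n) Ht).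
    assert (H1 := is_derive_partial_sum_a t n Ht).
    assert (Ha := recurrence_a t (S n) Ht); assert (Hadd := jump_r_succ_add t n Ht).
    evar_last.
    + apply (is_derive_div (fun s => partial_sum a (S (S n)) s - partial_sum a (S n) s
         - (2 * INR (S n) + 1 + alpha)) (fun s => s) t).
      * apply (is_derive_minus (V := R_NormedModule)).
        -- exact (is_derive_minus (V := R_NormedModule) _ _ _ _ _ H2 H1).
        -- apply (is_derive_const (2 * INR (S n) + 1 + alpha)).
      * apply (is_derive_id t).
      * lra.
    + change (partial_sum a (S (S n)) t) with (partial_sum a (S n) t + a (S n) t).
      unfold minus, plus, opp, one, zero; cbn -[INR partial_sum].
      replace (jump_r (S n) t) with ((t - a (S n) t) * jump_R (S n) t - jump_r n t) by lra.
      rewrite Ha, S_INR; field; lra.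
Qed.

End OrthogonalPolynomials.

(** * The fifth Painlevé equation *)

(* The last two hypotheses determine [be] and [be * x] from [Rf t] and [r t], so that
   [Rf] and [r] satisfy a closed first-order system. *)
Lemma painleve_V_of_system (alpha m t be x : R) (Rf r : R -> R) :
  0 < t -> Rf t <> 0 -> Rf t <> 1 ->
  (forall s, 0 < s -> is_derive Rf s
     ((2 * r s + (2 * m + alpha) * Rf s - s * Rf s * (1 - Rf s)) / s)) ->
  is_derive r t (be * (x - Rf t) / t) ->
  r t ^ 2 = be * Rf t * x ->
  be * (1 - Rf t - x) = m * (m + alpha) + (2 * m + alpha) * r t ->
  let S := fun s => 1 - 1 / Rf s in
  ex_derive S t /\ ex_derive (Derive S) t /\
  Derive (Derive S) t =
    (3 * S t - 1) / (2 * S t * (S t - 1)) * (Derive S t) ^ 2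
    - Derive S t / t
    - alpha ^ 2 / 2 * (S t - 1) ^ 2 / (t ^ 2 * S t)
    + (2 * m + 1 + alpha) * S t / t
    - 1 / 2 * (S t * (S t + 1)) / (S t - 1).
Proof.
  intros Ht HR0 HR1 HR Hr Hsq Hid S.
  set (N := 2 * m + alpha) in *.
  set (G := fun s => (2 * r s + N * Rf s - s * Rf s * (1 - Rf s)) / (s * Rf s ^ 2)).
  assert (HS : forall s, 0 < s -> Rf s <> 0 -> is_derive S s (G s)).
  { intros s Hs Hs0; assert (H := HR s Hs); unfold S.
    assert (Hex : ex_derive Rf s) by (eexists; exact H).
    auto_derive; [now repeat split|].
    replace (Derive (fun x => Rf x) s)
      with ((2 * r s + N * Rf s - s * Rf s * (1 - Rf s)) / s)
      by (symmetry; now apply is_derive_unique).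
    unfold G; field; split; [exact Hs0 | lra]. }
  (* The second derivative requires the formula for [Derive S] on a neighbourhood, where [Rf] stays
     nonzero by continuity. *)
  assert (Hloc : locally t (fun s => Derive S s = G s)).
  { assert (Hc : locally t (fun s => Rf s <> 0)).
    { assert (Hcont : continuous Rf t)
        by (apply (ex_derive_continuous (V := R_NormedModule)); eexists; now apply HR).
      exact (Hcont _ (open_neq 0 (Rf t) HR0)). }
    apply (filter_imp (fun s => 0 < s /\ Rf s <> 0)).
    - intros s [Hs Hs0]; now apply is_derive_unique, HS.
    - apply filter_and; [now apply open_gt | exact Hc]. }
  set (R' := (2 * r t + N * Rf t - t * Rf t * (1 - Rf t)) / t).
  set (r' := be * (x - Rf t) / t) in *.
  assert (HG : is_derive G t
    ((2 * r' + N * R' - Rf t * (1 - Rf t) - t * R' * (1 - 2 * Rf t)) / (t * Rf t ^ 2)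
     - (2 * r t + N * Rf t - t * Rf t * (1 - Rf t)) * (Rf t ^ 2 + t * (2 * Rf t * R'))
       / (t * Rf t ^ 2) ^ 2)).
  { assert (HRt : is_derive Rf t R') by now apply HR.
    assert (Hex : ex_derive Rf t) by (eexists; exact HRt).
    assert (Hex' : ex_derive r t) by (eexists; exact Hr).
    unfold G; auto_derive.
    - repeat split; try assumption.
      apply Rmult_integral_contrapositive_currified; [lra|].
      now apply (pow_nonzero (Rf t) 2).
    - replace (Derive (fun x => Rf x) t) with R' by (symmetry; now apply is_derive_unique).
      replace (Derive (fun x => r x) t) with r' by (symmetry; now apply is_derive_unique).
      field; split; [exact HR0 | lra]. }
  assert (HdS : Derive S t = G t) by now apply is_derive_unique, HS.
  split; [eexists; now apply HS|].
  split.
  { apply (ex_derive_ext_loc G); [|eexists; exact HG].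
    apply (filter_imp (fun s => Derive S s = G s)); [now symmetry | exact Hloc]. }
  rewrite (Derive_ext_loc (Derive S) G t Hloc), HdS, (is_derive_unique _ _ _ HG).
  (* Multiplying [Hid] by [Rf t] and replacing [be * Rf t * x] by [r t ^ 2] leaves a linear equation
     for [be], solvable because [Rf t] is neither 0 nor 1. *)
  assert (Hbe : be = (r t ^ 2 + Rf t * (m * (m + alpha) + N * r t)) / (Rf t * (1 - Rf t))).
  { assert (Hd : Rf t * (1 - Rf t) <> 0)
      by (apply Rmult_integral_contrapositive_currified; [exact HR0 | lra]).
    apply (Rmult_eq_reg_r (Rf t * (1 - Rf t))); [|exact Hd].
    unfold Rdiv; rewrite Rmult_assoc, Rinv_l, Rmult_1_r, <- Hid, Hsq by exact Hd; ring. }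
  (* [x] enters only through [be * x = r t ^ 2 / Rf t]. After this the claim is an identity of
     rational functions in [t], [Rf t], [r t], [m] and [alpha]. *)
  assert (Hr' : r' = (r t ^ 2 / Rf t - be * Rf t) / t).
  { unfold r'; rewrite Hsq; field; split; [exact HR0 | lra]. }
  rewrite Hr', Hbe; unfold R', G, S, N.
  field; repeat split; lra.
Qed.

(** The two nonvanishing conditions are those under which the equation makes sense at [t]:
    [P n t t <> 0] makes [1 / RnP] genuine, and [RnP <> 1] says that the solution, which occurs in
    denominators, is not 0 at [t]. *)
Theorem theorem5 (alpha A B : R) (P : nat -> R -> R -> R) (h a b : nat -> R -> R)
  (n : nat) (t : R) :
  0 < alpha -> 0 <= A -> 0 < B ->
  monic_OPS alpha A B P h -> three_term P a b ->
  (1 <= n)%nat -> 0 < t ->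
  P n t t <> 0 -> RnP alpha B P h n t <> 1 ->
  let S := SnP alpha B P h n in
  ex_derive S t /\ ex_derive (Derive S) t /\
  Derive (Derive S) t =
    (3 * S t - 1) / (2 * S t * (S t - 1)) * (Derive S t) ^ 2
    - Derive S t / t
    - alpha ^ 2 / 2 * (S t - 1) ^ 2 / (t ^ 2 * S t)
    + (2 * INR n + 1 + alpha) * S t / t
    - 1 / 2 * (S t * (S t + 1)) / (S t - 1)
  /\
  S t = (a n t - (2 * INR n + alpha + 1) - t) / (a n t - (2 * INR n + alpha + 1)).
Proof.
  intros Halpha HA HB HP Hrec Hn Ht HP0 HR1 S.
  destruct n as [|n]; [lia|]; clear Hn.
  set (Rf := RnP alpha B P h (Datatypes.S n)) in *.
  assert (HRf : forall s, 0 < s -> Rf s = jump_R alpha B P h (Datatypes.S n) s).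
  { intros s Hs; unfold Rf, RnP, jump_R; rewrite laguerre_pos by exact Hs.
    now rewrite <- Rmult_assoc. }
  assert (Hpos : locally t (fun s => 0 < s)) by now apply open_gt.
  assert (HR0 : Rf t <> 0).
  { assert (Hh := h_neq0 alpha A B P h Halpha HA HB HP t (Datatypes.S n) Ht).
    assert (Hl := laguerre_gt0 alpha t Ht).
    rewrite HRf by exact Ht; unfold jump_R, Rdiv.
    repeat apply Rmult_integral_contrapositive_currified; try lra.
    now apply Rinv_neq_0_compat. }
  (* With the degree written as a successor, [norm_ratio h n] and [jump_r n] carry the shifted index
     and are [beta] and [r] at that degree, while [jump_R n] belongs to the degree below. *)
  assert (HV := painleve_V_of_system alpha (INR (Datatypes.S n)) t (norm_ratio h n t)
                  (jump_R alpha B P h n t) Rf (jump_r alpha B P h n) Ht HR0 HR1).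
  change (fun s => 1 - 1 / Rf s) with S in HV.
  destruct HV as [H1 [H2 H3]].
  - intros s Hs; apply (is_derive_ext_loc (jump_R alpha B P h (Datatypes.S n))).
    + apply (filter_imp (fun u => 0 < u)); [|now apply open_gt].
      intros u Hu; symmetry; now apply HRf.
    + rewrite HRf, S_INR by exact Hs.
      now apply (is_derive_jump_R_S alpha A B P h a b).
  - rewrite HRf by exact Ht; now apply (is_derive_jump_r alpha A B P h a b).
  - rewrite HRf by exact Ht; now apply (jump_r_sq alpha A B P h).
  - rewrite HRf, S_INR by exact Ht; now apply (norm_ratio_jump_identity alpha A B P h a b).
  - split; [exact H1 | split; [exact H2 | split; [exact H3|]]].
    (* The denominator of the closed form is [t * Rf t], so the quotient reduces to
       [1 - 1 / Rf t]. *)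
    rewrite (recurrence_a alpha A B P h a b Halpha HA HB HP Hrec t _ Ht), <- HRf by exact Ht.
    unfold S, SnP; fold Rf; field; split; [|exact HR0].
    replace (2 * INR (Datatypes.S n) + 1 + alpha + t * Rf t
             - (2 * INR (Datatypes.S n) + alpha + 1)) with (t * Rf t) by ring.
    apply Rmult_integral_contrapositive_currified; [lra | exact HR0].
Qed.
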